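(* There is a partial function $f:\mathbb{R}\to\mathbb{R}$ that is infinite time computable but not one-tape computable.
   Context: $\mathbb{R}=2^\omega$. An infinite time Turing machine (ITTM) has three tapes (input, scratch, output) of cells indexed by $\omega$ with values in $\{0,1\}$, one head scanning a column of all three tapes, and a program with finitely many states including start, halt and a limit state. Successor steps are as for ordinary Turing machines (moving left from the leftmost cell leaves the head in place); at limit stages the head returns to the leftmost cell, the state becomes the limit state, and each cell takes the $\limsup$ of its earlier values. On input $a$, $a$ is on the input tape and other tapes are $0$; upon halting the output is the output tape. $f$ is computable if some program on input $a$ halts iff $a\in\mathrm{dom}(f)$, with output $f(a)$. A one-tape ITTM is the same with a single tape that initially holds the input and whose whole contents are the output upon halting; one-tape computable is defined analogously. *)

(* Defs.v *)
From mathcomp Require Import all_boot.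
Set Implicit Arguments. Unset Strict Implicit. Unset Printing Implicit Defensive.

(* Reals as Cantor space 2^omega. *)
Definition real := nat -> bool.

(* An infinite time Turing machine program with k tapes (alphabet {0,1}).
   Finitely many states 'I_nstates, with distinguished start, halt and limit
   states.  The transition reads the k symbols under the (single) head and
   returns a new state, the k symbols to write, and a direction
   (true = move right, false = move left). *)
Record program (k : nat) := Program {
  nstates : nat;
  st_start : 'I_nstates;
  st_halt : 'I_nstates;
  st_limit : 'I_nstates;
  delta : 'I_nstates -> {ffun 'I_k -> bool} ->
          'I_nstates * {ffun 'I_k -> bool} * bool
}.

Record config (k : nat) (P : program k) := Config {
  cstate : 'I_(nstates P);
  chead : nat;
  ctape : 'I_k -> nat -> bool
}.

(* One successor step.  Moving left from cell 0 leaves the head at 0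
   (truncated subtraction). *)
Definition step (k : nat) (P : program k) (c : config P) : config P :=
  let: (q', w, mvr) := @delta _ P (cstate c) [ffun i => ctape c i (chead c)] in
  @Config _ P q'
    (if mvr then (chead c).+1 else (chead c).-1)
    (fun i n => if n == chead c then w i else ctape c i n).

Definition well_order (T : Type) (lt : T -> T -> Prop) : Prop :=
  (forall x, ~ lt x x) /\
  (forall x y z, lt x y -> lt y z -> lt x z) /\
  (forall x y, lt x y \/ x = y \/ lt y x) /\
  well_founded lt.

(* A halting computation of P from initial configuration c0: a transfinite
   sequence of configurations indexed by a well-order (T, lt) with a greatest
   element top (the halting time). *)
Definition halting_run (k : nat) (P : program k) (c0 : config P)
  (T : Type) (lt : T -> T -> Prop) (c : T -> config P) (top : T) : Prop :=
  well_order lt /\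
  (forall t, t = top \/ lt t top) /\
  (forall t, (forall s, ~ lt s t) -> c t = c0) /\
  (forall t s, lt t s -> (forall u, ~ (lt t u /\ lt u s)) -> c s = step (c t)) /\
  (* limit stages: head at leftmost cell, limit state, cellwise limsup *)
  (forall s, (exists t, lt t s) -> (forall t, lt t s -> exists u, lt t u /\ lt u s) ->
     cstate (c s) = st_limit P /\ chead (c s) = 0 /\
     (forall i n, ctape (c s) i n = true <->
        (forall t, lt t s -> exists u, ~ lt u t /\ lt u s /\ ctape (c u) i n = true))) /\
  (forall t, lt t top -> cstate (c t) <> st_halt P) /\
  cstate (c top) = st_halt P.

Definition halts_with (k : nat) (P : program k) (c0 : config P)
  (out : config P -> real) (b : real) : Prop :=
  exists (T : Type) (lt : T -> T -> Prop) (c : T -> config P) (top : T),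
    halting_run c0 lt c top /\ out (c top) = b.

(* Three-tape machines: tape 0 = input, 1 = scratch, 2 = output. *)
Definition tape_in : 'I_3 := @Ordinal 3 0 isT.
Definition tape_out : 'I_3 := @Ordinal 3 2 isT.

Definition init3 (P : program 3) (a : real) : config P :=
  @Config _ P (st_start P) 0 (fun i n => if i == tape_in then a n else false).

Definition ittm_computable (f : real -> option real) : Prop :=
  exists P : program 3, forall a b,
    halts_with (init3 P a) (fun c => ctape c tape_out) b <-> f a = Some b.

Definition tape0 : 'I_1 := @Ordinal 1 0 isT.

Definition init1 (P : program 1) (a : real) : config P :=
  @Config _ P (st_start P) 0 (fun _ n => a n).

Definition one_tape_computable (f : real -> option real) : Prop :=
  exists P : program 1, forall a b,
    halts_with (init1 P a) (fun c => ctape c tape0) b <-> f a = Some b.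

(* Main.v *)
(** The function is the left shift restricted to the reals beginning with 1:
    it is onto but not total.  A three-tape machine copies the shifted input to
    its output tape in omega steps, and at the first limit reads cell 0 of the
    intact input tape to decide whether to halt.

    A one-tape machine that halts at time [lambda + k], with [lambda] a limit,
    outputs its tape at [lambda] up to a change of the first [k] cells, and both
    the change and the fact that it halts depend on these cells only.  A halt at
    a finite time is excluded, since the output would agree with the input beyond
    some cell, which the shift does not do.  As the shift is onto, compactness of
    Cantor space yields [N] such that every string of length [N] is obtained
    from a string of length [N] on which the machine halts within [N] steps of a
    limit.  By the pigeonhole principle the machine then halts within [N] steps
    of every limit, and so it halts on every input. *)

Require Import Defs.
From mathcomp Require Import all_boot.
From mathcomp Require Import boolp.
Set Implicit Arguments. Unset Strict Implicit. Unset Printing Implicit Defensive.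

(** * Runs *)

Section Runs.
Variables (k : nat) (P : program k).
Implicit Types c d : config P.

(** The clauses of [halting_run] that concern neither a last stage nor halting, so that one fixed
    long run serves every halting time. *)
Definition prerun (c0 : config P) (T : Type) (lt : T -> T -> Prop) (c : T -> config P) : Prop :=
  well_order lt /\
  (forall t, (forall s, ~ lt s t) -> c t = c0) /\
  (forall t s, lt t s -> (forall u, ~ (lt t u /\ lt u s)) -> c s = step (c t)) /\
  (forall s, (exists t, lt t s) -> (forall t, lt t s -> exists u, lt t u /\ lt u s) ->
     cstate (c s) = st_limit P /\ chead (c s) = 0 /\
     (forall i n, ctape (c s) i n = true <->
        (forall t, lt t s -> exists u, ~ lt u t /\ lt u s /\ ctape (c u) i n = true))).

(** The stages up to [t0] form an initial segment, so its minimal, successor and limit stages are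
    the same as in [T]. *)
Lemma halts_with_prerun (c0 : config P) (T : Type) (lt : T -> T -> Prop)
    (c : T -> config P) (t0 : T)
    (out : config P -> real) :
  prerun c0 lt c -> cstate (c t0) = st_halt P ->
  (forall t, lt t t0 -> cstate (c t) <> st_halt P) ->
  halts_with c0 out (out (c t0)).
Proof.
move=> [[irr [tr [tot wf]]] [ini [suc lim]]] h0 nh.
pose T' := {t : T | t = t0 \/ lt t t0}.
pose lt' (x y : T') := lt (sval x) (sval y).
have below s (s0 : s = t0 \/ lt s t0) t : lt t s -> t = t0 \/ lt t t0.
  by case: s0 => [-> | s0] ts; right => //; apply: tr ts s0.
exists T', lt', (fun x => c (sval x)), (exist _ t0 (or_introl erefl)).
split; last by [].
split.
  split; first by move=> x; apply: irr.
  split; first by move=> x y z; apply: tr.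
  split.
    move=> [x px] [y py]; rewrite /lt' /=.
    case: (tot x y) => [|[exy|]]; [by left| |by right; right].
    by right; left; subst y; congr exist; apply: Prop_irrelevance.
  move=> [x px]; elim/(well_founded_ind wf): x px => x IH px.
  by constructor=> -[y py] /= yx; apply: IH.
split.
  move=> [x [ex|px]]; last by right.
  by left; subst x; congr exist; apply: Prop_irrelevance.
split.
  move=> [x px] /= mx; apply: ini => s sx.
  exact: (mx (exist _ s (below _ px _ sx))).
split.
  move=> [x px] [y py]; rewrite /lt' /= => xy nb; apply: suc => // u [xu uy].
  exact: (nb (exist _ u (below _ py _ uy))).
split; last by split=> // -[x px]; apply: nh.
move=> [s ps]; rewrite /lt' /= => -[[t pt] /= ts] dense.
have [||-> [-> limsup]] := lim s; first by exists t.
  move=> u us; have [[v pv] /= uvs] := dense (exist _ u (below _ ps _ us)) us.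
  by exists v.
split=> //; split=> // i n; rewrite limsup; split=> H.
  move=> [u pu] /= us; have [v [vu [vs tv]]] := H u us.
  by exists (exist _ v (below _ ps _ vs)).
move=> u us; have [[v pv] /= Hv] := H (exist _ u (below _ ps _ us)) us.
by exists v.
Qed.

Definition limit_config (tape : 'I_k -> real) : config P := Config (st_limit P) 0 tape.

Definition limsup_tape (c : nat -> config P) (i : 'I_k) : real :=
  fun n => `[< forall m, exists2 j, m <= j & ctape (c j) i n >].

(* Time [(false, n)] is stage [n], and [(true, n)] is stage [omega + n]. *)
Definition omega2_lt (x y : bool * nat) : Prop :=
  (~~ x.1 && y.1) || ((x.1 == y.1) && (x.2 < y.2)).

Definition omega2_run (c0 : config P) (t : bool * nat) : config P :=
  let: (b, n) := t in
  iter n (@step k P)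
    (if b then limit_config (limsup_tape (fun j => iter j (@step k P) c0)) else c0).

Lemma omega2_well_order : well_order omega2_lt.
Proof.
split; first by move=> [[] x]; rewrite /omega2_lt /= ltnn.
split; first by move=> [[] x] [[] y] [[] z]; rewrite /omega2_lt //=; apply: ltn_trans.
split.
  move=> [[] x] [[] y]; rewrite /omega2_lt /=; [|by right; right|by left|];
    by case: (ltngtP x y) => [||->]; auto.
have acc_false n : Acc omega2_lt (false, n).
  by elim/ltn_ind: n => n IH; constructor=> -[[] m] lt_mn; [case/negP: lt_mn | apply: IH].
case=> -[] n; last exact: acc_false.
by elim/ltn_ind: n => n IH; constructor=> -[[] m] lt_mn; [apply: IH | apply: acc_false].
Qed.

Lemma omega2_prerun c0 : prerun c0 omega2_lt (omega2_run c0).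
Proof.
split; first exact: omega2_well_order.
split.
  by move=> [[] [|n]] //= mn; [case: (mn (false, 0))|case: (mn (true, n)) | case: (mn (false, n))];
    rewrite /omega2_lt /= ?ltnSn.
split.
  move=> [b n] [b' n'] lt_ nb.
  have ltS : omega2_lt (b, n) (b, n.+1) by rewrite /omega2_lt /= eqxx ltnSn orbT.
  have : ~ omega2_lt (b, n.+1) (b', n') by move=> H; apply: (nb (b, n.+1)).
  move: lt_; rewrite /omega2_lt /=; clear.
  case: b; case: b' => //= H1 /negP; rewrite -leqNgt => H2;
    by have -> : n' = n.+1 by apply/eqP; rewrite eqn_leq H1 H2.
move=> [b n] [t ts] dense.
(* Only [(true, 0)] is a limit: [(false, 0)] is minimal and every [(b, n.+1)] is a successor. *)
have [eb en] : b = true /\ n = 0.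
  case: n ts dense => [|n] ts dense.
    by case: b ts {dense} => //; case: t => [[] ?].
  case: (dense (b, n)); first by rewrite /omega2_lt /= eqxx ltnSn orbT.
  move=> [b' n']; rewrite /omega2_lt /= => -[].
  by case: b b' {ts dense} => -[] //= H1; rewrite ltnNge H1.
subst b n => {t ts dense}; split=> //; split=> // i n /=; split.
  move/asboolP=> H [[] m] //= _; have [j mj tj] := H m.
  by exists (false, j); rewrite /omega2_lt /= ltnNge mj.
move=> H; apply/asboolP => m; have [//|[[] j] [nlt [//= _ tj]]] := H (false, m).
by exists j => //; move/negP: nlt; rewrite -leqNgt.
Qed.

(** Halting configurations become fixed points, so having halted within [n] steps is a property of
    the [n]-th iterate that persists as [n] grows. *)
Definition hstep c := if cstate c == st_halt P then c else step c.

Lemma iter_hstep_halted c n : cstate c = st_halt P -> iter n hstep c = c.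
Proof. by move=> hc; elim: n => //= n ->; rewrite /hstep hc eqxx. Qed.

Lemma iter_hstep_halted_le c m n : m <= n ->
  cstate (iter m hstep c) = st_halt P -> iter n hstep c = iter m hstep c.
Proof. by move=> mn hm; rewrite -(subnK mn) iterD iter_hstep_halted. Qed.

(** Here [m] is the smaller of [n] and the first halting time, if there is one. *)
Lemma iter_hstep_step c n : exists2 m, iter n hstep c = iter m (@step k P) c &
  forall j, j < m -> cstate (iter j (@step k P) c) <> st_halt P.
Proof.
elim: n => [|n [m e nh]]; first by exists 0.
rewrite /= e /hstep; case: eqP => [hm|hm]; first by exists m.
exists m.+1 => // j; rewrite ltnS leq_eqVlt => /orP[/eqP-> //|]; exact: nh.
Qed.

Lemma halts_with_finite (c0 : config P) (out : config P -> real) n :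
  cstate (iter n hstep c0) = st_halt P -> halts_with c0 out (out (iter n hstep c0)).
Proof.
have [m -> nh] := iter_hstep_step c0 n => hm.
apply: (@halts_with_prerun _ _ _ _ (false, m) out (omega2_prerun c0)) => //.
by move=> [[] j] //=; apply: nh.
Qed.

Lemma halts_with_omega (c0 : config P) (out : config P -> real) n :
  let x := limsup_tape (fun j => iter j (@step k P) c0) in
  (forall j, cstate (iter j (@step k P) c0) <> st_halt P) ->
  cstate (iter n hstep (limit_config x)) = st_halt P ->
  halts_with c0 out (out (iter n hstep (limit_config x))).
Proof.
move=> x nh0; have [m -> nh] := iter_hstep_step (limit_config x) n => hm.
apply: (@halts_with_prerun _ _ _ _ (true, m) out (omega2_prerun c0)) => //.
by move=> [[] j] //=; apply: nh.
Qed.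

End Runs.

(** * Induction along a halting run *)

Section RunInduction.
Variables (k : nat) (P : program k) (c0 : config P).
Variables (T : Type) (lt : T -> T -> Prop) (c : T -> config P) (top : T).
Hypothesis run : halting_run c0 lt c top.

Lemma run_cases t :
  [\/ forall s, ~ lt s t,
      exists2 u, lt u t & forall v, ~ (lt u v /\ lt v t) |
      (exists u, lt u t) /\ (forall u, lt u t -> exists v, lt u v /\ lt v t)].
Proof.
case: (EM (exists u, lt u t)) => [ex|/forallNP]; last by constructor 1.
case: (EM (forall u, lt u t -> exists v, lt u v /\ lt v t)) => [|/existsNP[u]].
  by constructor 3.
by move/not_implyP=> [ut /forallNP nb]; constructor 2; exists u.
Qed.

Lemma run_lt_top t s : lt t s -> lt t top.
Proof.
by case: run => [[_ [tr _]] [max _]] ts; case: (max s) => [<- //|]; apply: tr.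
Qed.

Lemma run_ind (I : config P -> Prop) :
  I c0 ->
  (forall d, cstate d <> st_halt P -> I d -> I (step d)) ->
  (forall s, (exists t, lt t s) -> (forall t, lt t s -> exists u, lt t u /\ lt u s) ->
     (forall t, lt t s -> I (c t)) -> I (c s)) ->
  forall t, I (c t).
Proof.
case: run => [[_ [_ [_ wf]]] [_ [ini [suc [_ [nh _]]]]]] I0 IS IL t.
elim/(well_founded_ind wf): t => t IH.
case: (run_cases t) => [m|[u ut nb]|[ex dense]]; first by rewrite ini.
  by rewrite (suc u t) //; apply: IS (IH u ut); apply/nh/run_lt_top/ut.
exact: IL.
Qed.

Lemma run_min : exists t, forall s, ~ lt s t.
Proof.
case: run => [[_ [_ [_ wf]]] _]; apply: contrapT => /forallNP nm.
have: forall t : T, False; last by apply.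
move=> t; elim/(well_founded_ind wf): t => t IH.
by apply: (nm t) => s /IH.
Qed.

Lemma run_succ t s : lt t s -> exists u, [/\ lt t u, u = s \/ lt u s & c u = step (c t)].
Proof.
case: run => [[_ [tr [tot wf]]] [_ [_ [suc _]]]].
elim/(well_founded_ind wf): s => s IH ts.
case: (EM (exists v, lt t v /\ lt v s)) => [[v [tv vs]]|/forallNP nb].
  have [u [tu uv cu]] := IH v vs tv; exists u; split=> //; right.
  by case: uv => [-> //|]; move/tr; apply.
by exists s; split=> //; [left | apply: suc].
Qed.

Lemma run_finite_stages s n : (exists t, lt t s) ->
  (forall t, lt t s -> exists u, lt t u /\ lt u s) ->
  exists2 t, lt t s & c t = iter n (@step k P) c0.
Proof.
case: (run) => [[_ [tr [tot _]]] [_ [ini _]]] [t0 t0s] dense.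
elim: n => [|n [t ts ct]].
  have [m mm] := run_min; exists m; last exact: ini.
  case: (tot m t0) => [mt0|[-> //|/mm //]]; exact: tr mt0 t0s.
have [v [tv vs]] := dense t ts; have [u [tu uv cu]] := run_succ tv.
exists u; last by rewrite cu ct.
by case: uv => [-> //|]; move/tr; apply.
Qed.

(** Every ordinal is 0 or a limit, plus a finite number. The tapes [x] at the limit may be
    arbitrary. *)
Lemma run_decomposition t :
  (exists n, c t = iter n (@hstep k P) c0) \/
  (exists x n, c t = iter n (@hstep k P) (limit_config P x)).
Proof.
pattern (c t); apply: run_ind t => [|d nh|s ex dense _]; first by left; exists 0.
  have -> : step d = hstep d by rewrite /hstep; case: eqP.
  by case=> [[n ->]|[x [n ->]]]; [left; exists n.+1 | right; exists x, n.+1].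
case: run => [_ [_ [_ [_ [lim _]]]]]; have [st [hd _]] := lim s ex dense.
right; exists (ctape (c s)), 0; rewrite /= /limit_config -st -hd.
by case: (c s).
Qed.

(** A cell that is 1 from some stage below a limit onwards has limsup 1 there. *)
Lemma run_persist i n t u :
  (forall d : config P, ctape d i n -> ctape (step d) i n) ->
  ctape (c t) i n -> ~ lt u t -> ctape (c u) i n.
Proof.
case: (run) => [[irr [tr [tot wf]]] [_ [_ [suc [lim _]]]]] stepP ct.
have asym v w : lt v w -> ~ lt w v by move=> vw wv; apply: (irr v); apply: tr vw wv.
elim/(well_founded_ind wf): u => u IH nut.
case: (tot t u) => [tu|[<- //|/nut //]].
case: (run_cases u) => [/(_ t)/(_ tu) //|[v vu nb]|[ex dense]].
  by rewrite (suc v u) //; apply/stepP/IH => // vt; apply: (nb t).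
have [_ [_ limsup]] := lim u ex dense; apply/limsup => v vu.
case: (EM (lt v t)) => [vt|nvt]; first by exists t; split=> //; apply: asym.
by exists v; split=> //; split=> //; apply: IH.
Qed.

End RunInduction.

(** * Locality of finite computations *)

Section Locality.
Variables (k : nat) (P : program k).
Implicit Types c d : config P.

Definition agree N c d : Prop :=
  [/\ cstate c = cstate d, chead c = chead d &
      forall i n, n < N -> ctape c i n = ctape d i n].

Lemma chead_hstep c : chead (hstep c) <= (chead c).+1.
Proof.
rewrite /hstep; case: eqP => // _; rewrite /step.
by case: delta => [[q w] []] //=; apply: leq_trans (leq_pred _) _.
Qed.

Lemma hstep_agree N c d : chead c < N -> agree N c d -> agree N (hstep c) (hstep d).
Proof.
move=> hN [es eh et]; rewrite /hstep -es; case: eqP => // _; rewrite /step -es -eh.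
have -> : [ffun i => ctape d i (chead c)] = [ffun i => ctape c i (chead c)].
  by apply/ffunP => i; rewrite !ffunE et.
case: delta => [[q w] b]; split=> //= i n nN; case: eqP => // _; exact: et.
Qed.

(** The head moves at most one cell per step, so within [n] steps only cells below [chead c + n] are
    read. *)
Lemma iter_hstep_agree N n c d : chead c + n <= N -> agree N c d ->
  agree N (iter n (@hstep k P) c) (iter n (@hstep k P) d).
Proof.
elim: n c d => [//|n IH] c d hN cd; rewrite !iterSr; apply: IH.
  by apply: leq_trans hN; rewrite -addSnnS leq_add2r chead_hstep.
by apply: hstep_agree cd; apply: leq_trans hN; rewrite -addSnnS leq_addr.
Qed.

Lemma iter_hstep_agree0 n c d : agree n c d -> chead c = 0 ->
  agree n (iter n (@hstep k P) c) (iter n (@hstep k P) d).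
Proof. by move=> cd c0; apply: iter_hstep_agree => //; rewrite c0. Qed.

Lemma iter_hstep_tail n c i m : chead c + n <= m ->
  ctape (iter n (@hstep k P) c) i m = ctape c i m.
Proof.
elim: n c => [//|n IH] c hm; rewrite iterSr IH; last first.
  by apply: leq_trans hm; rewrite -addSnnS leq_add2r chead_hstep.
rewrite /hstep; case: eqP => // _; rewrite /step.
case: delta => [[q w] b] /=; case: eqP => // e.
by move: hm; rewrite e -addSnnS ltnNge leq_addr // => /(leq_trans (leq_addr _ _)); rewrite ltnn.
Qed.

End Locality.

(** * Compactness of Cantor space *)

(** König's argument: without a uniform bound, following children that have none yields a real with
    no good prefix. *)
Lemma fan (good : seq bool -> Prop) :
  (forall s b, good s -> good (rcons s b)) ->
  (forall x : real, exists n, good (mkseq x n)) ->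
  exists n, forall s, size s = n -> good s.
Proof.
move=> good_rcons bar.
have good_cat s w : good s -> good (s ++ w).
  by elim/last_ind: w => [|w b IH]; rewrite ?cats0 // -rcons_cat => /IH /good_rcons.
pose U s := exists n, forall w, size w = n -> good (s ++ w).
have U_children s : U (rcons s true) -> U (rcons s false) -> U s.
  move=> [m Hm] [n Hn]; exists (maxn m n).+1 => -[//|b w] [sw].
  (* After the bit [b], the first [m] or [n] further bits already give a good string. *)
  rewrite -cat_rcons -(cat_take_drop (if b then m else n) w) catA; apply: good_cat.
  by case: b; [apply: Hm | apply: Hn]; rewrite size_takel // sw ?leq_maxl ?leq_maxr.
apply: contrapT => nU0; have {}nU0 : ~ U [::] by [].
(* The path takes the child [true] unless [U] holds there, in which case [U] must fail at
   [false]. *)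
pose path n := iter n (fun s => rcons s (~~ `[< U (rcons s true) >])) [::].
have nU n : ~ U (path n).
  elim: n => //= n IH; case: asboolP => //= Ut Uf; exact: (IH (U_children _ Ut Uf)).
pose x n := ~~ `[< U (rcons (path n) true) >].
have pathE n : path n = mkseq x n by elim: n => //= n IH; rewrite mkseqS -IH.
have [n good_n] := bar x; apply: (nU n); rewrite pathE.
by exists 0 => w /size0nil->; rewrite cats0.
Qed.

(** * The partial shift *)

Definition shift (a : real) : real := fun n => a n.+1.

Definition partial_shift (a : real) : option real := if a 0 then Some (shift a) else None.

(** * No one-tape machine computes the partial shift *)

Section OneTape.
Variable P : program 1.
Hypothesis compP : forall a b,
  halts_with (init1 P a) (fun c => ctape c tape0) b <-> partial_shift a = Some b.

Let lconf (x : real) : config P := limit_config P (fun _ => x).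
Let hiter n (c : config P) : config P := iter n (@hstep 1 P) c.

Lemma agree_init1 N (a b : real) : (forall n, n < N -> a n = b n) ->
  agree N (init1 P a) (init1 P b).
Proof. by move=> e; split=> //= _; apply: e. Qed.

Lemma agree_lconf N (a b : real) : (forall n, n < N -> a n = b n) ->
  agree N (lconf a) (lconf b).
Proof. by move=> e; split=> //= _; apply: e. Qed.

(* The shift of the altered input must agree with it beyond [n], whereas
   there it is alternating. *)
Lemma no_finite_halt (a : real) n : a 0 -> cstate (hiter n (init1 P a)) <> st_halt P.
Proof.
(* The threshold is [n.+1] rather than [n] so that cell 0 keeps its 1 even when [n = 0]. *)
move=> a0 hn; pose a' m := if m < n.+1 then a m else odd m.
have ag : agree n (init1 P a) (init1 P a').
  by apply: agree_init1 => m mn; rewrite /a' ltnS ltnW.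
have [st _ _] := iter_hstep_agree0 ag erefl.
have := @halts_with_finite _ _ (init1 P a') (fun c => ctape c tape0) n.
rewrite -st => /(_ hn) /compP; rewrite /partial_shift {1}/a' /= a0 => -[e].
have := congr1 (fun y => y n.+1) e; rewrite iter_hstep_tail ?add0n //=.
by rewrite /shift /a' ltnn [n.+2 < _]ltnNge leqnSn //= negbK; case: odd.
Qed.

(** The length of [s] bounds both the steps after the limit and the cells inspected, so only a
    prefix of [x] of that length matters. *)
Let good (s : seq bool) : Prop := exists2 x : real,
  cstate (hiter (size s) (lconf x)) = st_halt P &
  forall i, i < size s -> ctape (hiter (size s) (lconf x)) tape0 i = nth false s i.

Lemma good_rcons s b : good s -> good (rcons s b).
Proof.
(* Cells from [size s] on are out of reach in [size s] steps, so filling them with [b] keeps the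
   halt and appends [b] to the output. *)
move=> [x hx tx]; pose y n := if n < size s then x n else b.
have ag : agree (size s) (lconf x) (lconf y).
  by apply: agree_lconf => n ns; rewrite /y ns.
have [st _ tp] := iter_hstep_agree0 ag erefl.
have hy : cstate (hiter (size s) (lconf y)) = st_halt P by rewrite -st.
have e : hiter (size s).+1 (lconf y) = hiter (size s) (lconf y).
  exact: iter_hstep_halted_le.
exists y; rewrite size_rcons e // => i; rewrite ltnS nth_rcons.
case: ltngtP => // [si _|-> _]; first by rewrite -tp // tx.
by rewrite [LHS]iter_hstep_tail ?add0n //= /y ltnn.
Qed.

Lemma good_bar (b : real) : exists n, good (mkseq b n).
Proof.
(* Prepending 1 gives a point of the domain whose shift is [b]. *)
pose a n := if n is m.+1 then b m else true.
have [T [lt [c [top [run out]]]]] : halts_with (init1 P a) (fun c => ctape c tape0) b.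
  by apply/compP.
have halt_top : cstate (c top) = st_halt P by case: run => [_ [_ [_ [_ [_ [_ ->]]]]]].
case: (run_decomposition run top) => [[n e]|[x [n e]]].
  by case: (@no_finite_halt a n) => //; rewrite /hiter -e.
have e' : c top = hiter n (lconf (x tape0)).
  rewrite e; congr (iter _ _ (limit_config _ _)).
  by apply: funext => i; rewrite (ord1 i); congr x; apply: val_inj.
exists n, (x tape0); rewrite size_mkseq -e' // => i ni.
by rewrite nth_mkseq // out.
Qed.

Lemma every_limit_halts : exists n, forall x, cstate (hiter n (lconf x)) = st_halt P.
Proof.
have [n all_good] := fan good_rcons good_bar; exists n.
pose ext (y : n.-tuple bool) : real := fun i => nth false y i.
pose A := [set y : n.-tuple bool | cstate (hiter n (lconf (ext y))) == st_halt P].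
pose res (y : n.-tuple bool) : n.-tuple bool :=
  [tuple ctape (hiter n (lconf (ext y))) tape0 i | i < n].
have restrict (x : real) :
    agree n (lconf x) (lconf (ext [tuple x i | i < n])).
  by apply: agree_lconf => m mn; rewrite /ext (nth_mktuple _ _ (Ordinal mn)).
have res_onto : [set: n.-tuple bool] \subset res @: A.
  apply/subsetP => z _; have [x] := all_good z (size_tuple z).
  rewrite size_tuple => hx tx; have [st _ tp] := iter_hstep_agree0 (restrict x) erefl.
  apply/imsetP; exists [tuple x i | i < n]; first by rewrite inE -st -/(hiter _ _) hx.
  apply: eq_from_tnth => i; rewrite tnth_mktuple -tp //.
  by rewrite -/(hiter _ _) tx // -tnth_nth.
(* The images of the halting strings under [res] exhaust all [n]-tuples, so [A] has as many elements
   as there are tuples. *)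
have A_full : A = setT.
  apply/eqP; rewrite eqEcard subsetT.
  exact: leq_trans (subset_leq_card res_onto) (leq_imset_card _ _).
move=> x; have [-> _ _] := iter_hstep_agree0 (restrict x) erefl.
by apply/eqP; have := in_setT [tuple x i | i < n]; rewrite -A_full inE.
Qed.

(** The zero input is outside the domain, yet the machine halts on it at a finite stage or finitely
    many steps after stage omega. *)
Lemma partial_shift_not_one_tape : False.
Proof.
pose a : real := fun=> false; pose out (c : config P) := ctape c tape0.
case: (EM (exists j, cstate (hiter j (init1 P a)) = st_halt P)) => [[j hj]|/forallNP nh].
  by have /compP := halts_with_finite out hj.
have e j : iter j (@step 1 P) (init1 P a) = hiter j (init1 P a).
  elim: j => //= j ->; rewrite [in RHS]/hstep; case: eqP => // /nh //.
have [n all_halt] := every_limit_halts.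
pose x := limsup_tape (fun j => iter j (@step 1 P) (init1 P a)).
have ex : limit_config P x = lconf (x tape0).
  congr limit_config; apply: funext => i; rewrite (ord1 i); congr x; exact: val_inj.
have hx : cstate (iter n (@hstep 1 P) (limit_config P x)) = st_halt P.
  by rewrite ex; apply: all_halt.
have nh' j : cstate (iter j (@step 1 P) (init1 P a)) <> st_halt P.
  by rewrite e; apply: nh.
by have /compP := halts_with_omega out nh' hx.
Qed.

End OneTape.

(** * A three-tape machine for the partial shift *)

Section ThreeTapes.

Definition qS : 'I_5 := @Ordinal 5 0 isT.
Definition qR : 'I_5 := @Ordinal 5 1 isT.
Definition qW : 'I_5 := @Ordinal 5 2 isT.
Definition qL : 'I_5 := @Ordinal 5 3 isT.
Definition qH : 'I_5 := @Ordinal 5 4 isT.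

(* In state [qR] the machine looks for the next 1 of the input; on finding one it
   steps left, writes a 1 on the output tape in state [qW], and moves right twice
   through [qS] to resume the search.  The input tape is never altered. *)
Definition shift_program : program 3 :=
  @Program 3 5 qS qH qL (fun q r =>
    match nat_of_ord q with
    | 0 => (qR, r, true)
    | 1 => if r tape_in then (qW, r, false) else (qR, r, true)
    | 2 => (qS, [ffun i => (i == tape_out) || r i], true)
    | 3 => if r tape_in then (qH, r, false) else (qL, r, false)
    | _ => (qH, r, false)
    end).

Let conf q h tp : config shift_program := @Config 3 shift_program q h tp.

Definition mark (tp : 'I_3 -> real) h : 'I_3 -> real :=
  fun i n => ((n == h) && (i == tape_out)) || tp i n.

Lemma shift_stepE q h tp : step (conf q h tp) =
  match nat_of_ord q with
  | 0 => conf qR h.+1 tp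
  | 1 => if tp tape_in h then conf qW h.-1 tp else conf qR h.+1 tp
  | 2 => conf qS h.+1 (mark tp h)
  | 3 => if tp tape_in h then conf qH h.-1 tp else conf qL h.-1 tp
  | _ => conf qH h.-1 tp
  end.
Proof.
have rewr : (fun i n => if n == h then [ffun j => tp j h] i else tp i n) = tp.
  by apply: funext => i; apply: funext => n; case: eqP => // ->; rewrite ffunE.
rewrite /step /=; case: (nat_of_ord q) => [|[|[|[|m]]]] /=; rewrite ?ffunE ?rewr //.
- by case: (tp tape_in h); rewrite rewr.
- congr Config; apply: funext => i; apply: funext => n.
  by rewrite /mark; case: eqP => // ->; rewrite !ffunE.
- by case: (tp tape_in h); rewrite rewr.
Qed.

Lemma shift_step_out (d : config shift_program) n :
  ctape d tape_out n -> ctape (step d) tape_out n.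
Proof.
case: d => q h tp /= out; rewrite (shift_stepE q h tp).
case: (nat_of_ord q) => [|[|[|[|m]]]] //=; last by case: (tp tape_in h).
  by case: (tp tape_in h).
by rewrite /mark out orbT.
Qed.

Variable a : real.
Let d0 := init3 shift_program a.
Let cs n := iter n (@step 3 shift_program) d0.

(** The detour for a 1 at [n.+1] takes three steps and ends at [n.+2], so no cell after cell 0 is
    missed. *)
Lemma shift_program_reaches n : exists m tp,
  cs m = conf qR n.+1 tp /\ tp tape_in = a.
Proof.
elim: n => [|n [m [tp [e ea]]]].
  by exists 1; eexists; rewrite /cs /= shift_stepE; split.
case an : (a n.+1); last first.
  by exists m.+1, tp; rewrite /cs /= -/(cs m) e shift_stepE /= ea an.
exists m.+3; eexists; rewrite /cs /= -/(cs m) e shift_stepE /= ea an.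
rewrite !shift_stepE /=; split; first by [].
by apply: funext => j; rewrite /mark andbF ea.
Qed.

Lemma shift_program_writes n : a n.+1 -> exists m, ctape (cs m) tape_out n.
Proof.
move=> an; have [m [tp [e ea]]] := shift_program_reaches n.
by exists m.+2; rewrite /cs /= -/(cs m) e shift_stepE /= ea an shift_stepE /= /mark eqxx.
Qed.

(** The numerals 1 to 4 are [qR], [qW], [qL], [qH]. The clause for [qR] makes its left move a
    genuine one; the clause for [qL] ensures that cell 0 is tested and that the output is complete
    before any halt. *)
Definition shift_inv (d : config shift_program) : Prop :=
  [/\ ctape d tape_in = a,
      forall n, ctape d tape_out n -> a n.+1,
      cstate d = 1 :> nat -> 0 < chead d,
      cstate d = 2 :> nat -> a (chead d).+1 &
      (cstate d = 3 :> nat -> chead d = 0 /\ forall n, a n.+1 -> ctape d tape_out n) /\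
      (cstate d = 4 :> nat -> a 0 /\ forall n, a n.+1 -> ctape d tape_out n)].

Lemma shift_inv_step (d : config shift_program) : cstate d <> qH -> shift_inv d -> shift_inv (step d).
Proof.
case: d => q h tp /= nH [/= ea sound hR hW [hL hH]]; rewrite (shift_stepE q h tp).
case: q nH hR hW hL hH => [[|[|[|[|[|//]]]]] q5] /= nH hR hW hL hH.
- by split.
- case tph: (tp tape_in h); split=> //= _; rewrite prednK ?hR // -ea; exact: tph.
- split=> //=; first by apply: funext => n; rewrite /mark andbF ea.
  by move=> n; rewrite /mark; case: eqP => [-> _|_ /sound //]; apply: hW.
- have [-> out] := hL erefl.
  case tph: (tp tape_in 0); split=> //=.
  by split=> // _; split=> //; rewrite -ea.
- by case: nH; apply: val_inj.
Qed.

Lemma shift_program_sound b :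
  halts_with d0 (fun c => ctape c tape_out) b -> partial_shift a = Some b.
Proof.
move=> [T [lt [c [top [run <-]]]]].
have inv : forall t, shift_inv (c t).
  apply: (run_ind run); [by split | exact: shift_inv_step |].
  move=> s ex dense IH; case: (run) => [_ [_ [_ [_ [lim _]]]]].
  have [st [hd limsup]] := lim s ex dense; have [t0 t0s] := ex.
  split; rewrite ?st //.
  - apply: funext => n; apply/idP/idP => [/limsup /(_ t0 t0s) [u [_ [us]]]|an].
      by have [-> _ _ _ _] := IH u us.
    apply/limsup => t ts; exists t; split; first by case: run => [[irr _] _]; apply: irr.
    by split=> //; have [-> _ _ _ _] := IH t ts.
  - move=> n /limsup /(_ t0 t0s) [u [_ [us]]].
    by have [_ sound _ _ _] := IH u us; apply: sound.
  (* At a limit all finite stages are past, so each required 1 has been written, and it is never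
     erased. *)
  split=> // _; split=> // n /shift_program_writes [m wm].
  have [t ts ct] := run_finite_stages run m ex dense.
  apply: (run_persist run (t := t)); first by move=> d; apply: shift_step_out.
    by rewrite ct.
  by move=> st'; case: run => [[irr [tr _]] _]; apply: (irr t); apply: tr ts st'.
have halt_top : cstate (c top) = qH by case: run => [_ [_ [_ [_ [_ [_ ->]]]]]].
have [_ sound _ _ [_]] := inv top; rewrite halt_top => /(_ erefl) [a0 complete].
rewrite /partial_shift a0; congr Some; apply: funext => n.
by apply/idP/idP; [apply: complete | apply: sound].
Qed.

Lemma shift_program_halts : a 0 ->
  exists b, halts_with d0 (fun c => ctape c tape_out) b.
Proof.
move=> a0; pose out (c : config shift_program) := ctape c tape_out.
(* States below 3 are [qS], [qR] and [qW], so there is no halt before omega. *)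
have inv n : cstate (cs n) < 3 /\ ctape (cs n) tape_in = a.
  elim: n => //= n; case: (cs n) => q h tp /= [q3 ea].
  rewrite (shift_stepE q h tp); case: (nat_of_ord q) q3 => [|[|[|//]]] _ //=.
    by case: (tp _ h).
  by split=> //; apply: funext => m; rewrite /mark andbF ea.
(* One step after the limit suffices: [qL] reads the 1 in cell 0 and enters [qH]. *)
eexists; apply: (@halts_with_omega _ _ d0 out 1).
  by move=> j; have [+ _] := inv j => /[swap]; rewrite -/(cs j) => ->.
set x := limsup_tape _; have x0 : x tape_in 0.
  by apply/asboolP => m; exists m => //; rewrite -/(cs m); have [_ ->] := inv m.
by rewrite /= /hstep /= (shift_stepE qL 0 x) /= x0.
Qed.

End ThreeTapes.

Lemma partial_shift_computable : ittm_computable partial_shift.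
Proof.
exists shift_program => a b; split; first exact: shift_program_sound.
rewrite /partial_shift; case a0: (a 0) => // -[<-].
(* Some output exists, and soundness identifies it as the shift. *)
have [b' hb'] := shift_program_halts a0.
by have := shift_program_sound hb'; rewrite /partial_shift a0 => -[->].
Qed.

Theorem mainTheorem9 :
  exists f : real -> option real, ittm_computable f /\ ~ one_tape_computable f.
Proof.
exists partial_shift; split; first exact: partial_shift_computable.
by case=> P; apply: partial_shift_not_one_tape.
Qed.
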